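(* Let $q$ be any prime power. There exists a set of $q^{12}+2q^8+2q^7+q^6+q^5+q^4+1$ planes of the projective space ${\rm PG}(8,q)$ such that any two distinct planes of the set intersect in at most one point.
   Context: ${\rm PG}(8,q)$ is the projective space of dimension $8$ over the finite field ${\rm GF}(q)$; a plane is a $2$-dimensional projective subspace (a $3$-dimensional vector subspace of ${\rm GF}(q)^9$). *)

(* Defs.v *)
From HB Require Import structures.
From mathcomp Require Import all_boot all_order all_algebra all_field.
Set Implicit Arguments. Unset Strict Implicit. Unset Printing Implicit Defensive.
Import GRing.Theory.

(* Planes of PG(8,q) = 3-dimensional subspaces of the row space GF(q)^9. *)
Definition is_plane (F : finFieldType) (U : {vspace 'rV[F]_9}) : bool :=
  \dim U == 3.

Definition meet_at_most_point (F : finFieldType) (U V : {vspace 'rV[F]_9}) : bool :=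
  (\dim (U :&: V) <= 1)%N.

(* Main.v *)
(**
Let K be the cubic extension of GF(q), s the Frobenius map, and split V = K^3 as
W + W' + Z, where W' is dual to W through the trace form Tr(w y); put S = W' + Z.
The q^12 graphs over W of x |-> (a s x + b s^2 x, c s x + d s^2 x) form a lifted
maximum rank distance code.  Among them, the q^9 graphs lying in the quadric cone
Tr(w y) = 0 with vertex Z (those with a + s b = 0) are the skew ones; remove them.
The lines of the cone disjoint from S that they covered are covered again by
q^9 + q^8 + q^7 planes of the cone from the other ("Greek") ruling, each meeting S in
one point outside Z.  Since a Greek plane has no line in common with planes whose only
cone lines outside S pass through Z, one can still add planes meeting S in a line:
one through each of the q^8 + q^7 + q^6 lines of S which project to a line of W' (the
"square" maps, whose W-part is y |-> Tr(w y) w), q^5 + q^4 planes through points of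
Z, and Z itself.
*)
Require Import Defs.
From HB Require Import structures.
From mathcomp Require Import all_boot all_order all_algebra all_field.
From mathcomp Require Import ring.
Set Implicit Arguments. Unset Strict Implicit. Unset Printing Implicit Defensive.
Import GRing.Theory.
Local Open Scope ring_scope.

(** * Trace identities for a field with an automorphism of order dividing 3 *)

Section CyclicCubic.
Variables (K : fieldType) (s : {rmorphism K -> K}).
Hypothesis s3 : forall x, s (s (s x)) = x.

Definition tr x : K := x + s x + s (s x).

(* For [x, y != 0] this says that [x / y] is fixed by [s]. *)
Definition proportional x y : Prop := x * s y = y * s x.

Lemma s_tr x : s (tr x) = tr x.
Proof. by rewrite /tr !rmorphD s3; ring. Qed.

Lemma trD x y : tr (x + y) = tr x + tr y.
Proof. by rewrite /tr !rmorphD; ring. Qed.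

Lemma tr_fixed k x : s k = k -> tr (k * x) = k * tr x.
Proof. by move=> kE; rewrite /tr !rmorphM !kE; ring. Qed.

Lemma tr0 : tr 0 = 0.
Proof. by rewrite /tr !rmorph0 !addr0. Qed.

Lemma proportionalP x y : x != 0 -> proportional x y -> s (y / x) = y / x.
Proof.
move=> x0 xy; have sx0 : s x != 0 by rewrite fmorph_eq0.
by rewrite fmorph_div; apply/eqP; rewrite eqr_div // mulrC xy.
Qed.

Lemma proportional_sym x y : proportional x y -> proportional y x.
Proof. by move=> /esym. Qed.

Lemma proportional_fixed a x y : s x = x -> s y = y -> proportional (x * a) (y * a).
Proof. by rewrite /proportional !rmorphM => -> ->; ring. Qed.

Lemma proportional_s x y : proportional (s x) (s y) -> proportional x y.
Proof. by rewrite /proportional -!rmorphM => /fmorph_inj. Qed.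

Lemma conj_neq r : s r != r -> (s (s r) != s r) * (s (s r) != r).
Proof.
move=> nr; split; first by rewrite (inj_eq (fmorph_inj s)).
by apply: contra_neq nr => /(congr1 s); rewrite s3.
Qed.

(** Two independent trace conditions leave one projective point: eliminating [s (s z)] between them
    determines the ratio of [s z] to [z]. *)
Lemma tr_proportional r x y : s r != r ->
  tr x = 0 -> tr (x * r) = 0 -> tr y = 0 -> tr (y * r) = 0 -> proportional x y.
Proof.
rewrite /tr !rmorphM => nr x1 x2 y1 y2; have [_ nr2] := conj_neq nr.
have key z : z + s z + s (s z) = 0 ->
    z * r + s z * s r + s (s z) * s (s r) = 0 ->
    z * (r - s (s r)) = s z * (s (s r) - s r).
  move=> z1 z2; apply/eqP; rewrite -subr_eq0; apply/eqP.
  transitivity (z * r + s z * s r + s (s z) * s (s r) - s (s r) * (z + s z + s (s z))).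
    by ring.
  by rewrite z1 z2 mulr0 subr0.
have {}x2 := key _ x1 x2; have {}y2 := key _ y1 y2.
have d0 : r - s (s r) != 0 by rewrite subr_eq0 eq_sym.
apply: (mulfI d0); rewrite !mulrA ![_ * x]mulrC ![_ * y]mulrC x2 y2; ring.
Qed.

(** Lagrange interpolation at the three conjugates of [r]: weighting by the coefficients of (X - s
    r)(X - s (s r)) kills the terms in [s x] and [s (s x)]. *)
Lemma tr_nondegenerate r x : s r != r ->
  tr x = 0 -> tr (r * x) = 0 -> tr (r * r * x) = 0 -> x = 0.
Proof.
rewrite /tr !rmorphM => nr h0 h1 h2; have [nr1 nr2] := conj_neq nr.
suff : x * ((r - s r) * (r - s (s r))) = 0.
  move/eqP; rewrite !mulf_eq0 !subr_eq0 ![r == _]eq_sym (negPf nr) (negPf nr2).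
  by rewrite !orbF => /eqP.
transitivity (s r * s (s r) * (x + s x + s (s x))
   - (s r + s (s r)) * (r * x + s r * s x + s (s r) * s (s x))
   + (r * r * x + s r * s r * s x + s (s r) * s (s r) * s (s x))).
  by ring.
by rewrite h0 h1 h2 !mulr0 subr0 addr0.
Qed.

(** Cramer's rule, the determinant being the image under [s] of [x * s y - y * s x]. This is the
    rank distance property of the code. *)
Lemma gabidulin_ker a b x y :
  a * s x + b * s (s x) = 0 -> a * s y + b * s (s y) = 0 ->
  (a = 0 /\ b = 0) \/ proportional x y.
Proof.
move=> hx hy; have [d0|d0] := eqVneq (s x * s (s y) - s y * s (s x)) 0.
  by right; apply/proportional_s/eqP; rewrite -subr_eq0 d0.
left; split; apply: (mulIf d0); rewrite mul0r.
  transitivity (s (s y) * (a * s x + b * s (s x)) - s (s x) * (a * s y + b * s (s y))).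
    by ring.
  by rewrite hx hy !mulr0 subr0.
transitivity (s x * (a * s y + b * s (s y)) - s y * (a * s x + b * s (s x))).
  by ring.
by rewrite hx hy !mulr0 subr0.
Qed.

(** For [e != 0] the quadratic form [tr (e * x * s x)] has no totally singular line. With
    [y = r * x], the three conditions are traces of [E] against 1, [r + s r] and [r * s r]; combined
    as in (r - X)(r - s X) summed over conjugates, they isolate [s E]. *)
Lemma quad_form_line e x y :
  tr (e * x * s x) = 0 -> tr (e * y * s y) = 0 ->
  tr (e * (x * s y + y * s x)) = 0 -> e = 0 \/ proportional x y.
Proof.
have [->|x0] := eqVneq x 0; first by move=> *; right; rewrite /proportional rmorph0; ring.
have [r ->] : exists r, y = r * x by exists (y / x); rewrite divfK.
have [rF|nr] := eqVneq (s r) r;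
  first by move=> *; right; rewrite /proportional rmorphM rF; ring.
move=> h1 h2 h3; left; have [nr1 nr2] := conj_neq nr.
pose E := e * x * s x.
have {}h2 : tr (E * (r * s r)) = 0 by rewrite -h2 /E rmorphM; congr tr; ring.
have {}h3 : tr (E * (r + s r)) = 0 by rewrite -h3 /E rmorphM; congr tr; ring.
have key z : s z * ((r - s r) * (r - s (s r))) =
    tr (z * (r * s r)) - r * tr (z * (r + s r)) + r ^+ 2 * tr z.
  by rewrite /tr !(rmorphM, rmorphD) !s3; ring.
have /eqP := key E; rewrite h1 h2 h3 !mulr0 subr0 addr0.
rewrite !mulf_eq0 !subr_eq0 ![r == _]eq_sym (negPf nr) (negPf nr2) !orbF.
by rewrite !(fmorph_eq0, mulf_eq0) (negPf x0) !orbF => /eqP.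
Qed.

Lemma fixedB x y : s x = x -> s y = y -> s (x - y) = x - y.
Proof. by move=> xE yE; rewrite rmorphB xE yE. Qed.

Lemma fixed_proportional x y : s x = x -> s y = y -> proportional x y.
Proof. by rewrite /proportional => -> ->; apply: mulrC. Qed.

Lemma proportional_mul2l a x y : a != 0 -> proportional (a * x) (a * y) -> proportional x y.
Proof.
move=> a0; rewrite /proportional !rmorphM => h.
have d0 : a * s a != 0 by rewrite mulf_neq0 ?fmorph_eq0.
by apply: (mulfI d0); transitivity (a * x * (s a * s y)); [ring | rewrite h; ring].
Qed.

(** * Planes given by parametrizations, with the fixed field of [s] as scalars *)

Definition sc (k : K) (v : K * K * K) : K * K * K := (k * v.1.1, k * v.1.2, k * v.2).

Definition fixlinear (f : K -> K * K * K) : Prop :=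
  forall k x y, s k = k -> f (k * x + y) = sc k (f x) + f y.

Definition trivker (f : K -> K * K * K) : Prop := forall x, f x = 0 -> x = 0.

(** For linear maps: the images share at most one projective point. Only the parameters of [f] are
    compared, so a proof may put the more convenient plane first. *)
Definition meets (f g : K -> K * K * K) : Prop :=
  forall x1 x2 y1 y2, f x1 = g y1 -> f x2 = g y2 -> proportional x1 x2.

Lemma pair3_eq (u v : K * K * K) : u.1.1 = v.1.1 -> u.1.2 = v.1.2 -> u.2 = v.2 -> u = v.
Proof. by case: u v => [[? ?] ?] [[? ?] ?] /= -> -> ->. Qed.

Lemma fixlinear0 f : fixlinear f -> f 0 = 0.
Proof.
move=> lf; have := lf (-1) 0 0; rewrite mulr0 addr0 rmorphN rmorph1 => -> //.
by apply: pair3_eq => /=; ring.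
Qed.

Lemma fixlinear_comb f k x y : fixlinear f -> s k = k -> f (y - k * x) = f y - sc k (f x).
Proof.
move=> lf kE; rewrite addrC -mulNr lf ?rmorphN ?kE // addrC; congr (_ + _).
by rewrite /sc !mulNr.
Qed.

Lemma scaled_proportional k x y : s k = k -> y = k * x -> proportional x y.
Proof. by rewrite /proportional => kE ->; rewrite rmorphM kE; ring. Qed.

Lemma proportional_transfer f g x1 x2 y1 y2 : fixlinear f -> fixlinear g -> trivker f ->
  f x1 = g y1 -> f x2 = g y2 -> proportional y1 y2 -> proportional x1 x2.
Proof.
move=> lf lg kf e1 e2 cy.
have [y10|y10] := eqVneq y1 0.
  by rewrite y10 fixlinear0 // in e1; rewrite (kf _ e1) /proportional rmorph0 mul0r mulr0.
have kE := proportionalP y10 cy; set k := y2 / y1 in kE.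
have : f (x2 - k * x1) = 0.
  rewrite (fixlinear_comb _ _ lf kE) e1 e2.
  by rewrite -(fixlinear_comb _ _ lg kE) /k divfK // subrr fixlinear0.
by move/kf/eqP; rewrite subr_eq0 => /eqP; apply: scaled_proportional.
Qed.

(* If the functional [l] vanishes at no nonzero common vector of two planes and
   its values there are proportional, then the planes meet in at most a point. *)
Lemma meets_functional f g (l : K -> K) : fixlinear f -> fixlinear g ->
  (forall k x y, s k = k -> l (y - k * x) = l y - k * l x) ->
  (forall x y, f x = g y -> l x = 0 -> x = 0) ->
  (forall x1 x2 y1 y2, f x1 = g y1 -> f x2 = g y2 -> proportional (l x1) (l x2)) ->
  meets f g.
Proof.
move=> lf lg ll kl cl x1 x2 y1 y2 e1 e2.
have [l0|l0] := eqVneq (l x1) 0; first by rewrite (kl _ _ e1 l0) /proportional rmorph0; ring.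
have kE := proportionalP l0 (cl _ _ _ _ e1 e2); set k := l x2 / l x1 in kE.
have e : f (x2 - k * x1) = g (y2 - k * y1).
  by rewrite (fixlinear_comb _ _ lf kE) (fixlinear_comb _ _ lg kE) e1 e2.
apply: (scaled_proportional kE); apply/eqP; rewrite -subr_eq0; apply/eqP/(kl _ _ e).
by rewrite ll // /k divfK // subrr.
Qed.

(** By [tr_nondegenerate] the trace cannot vanish at all of 1, [r] and [r * r]; a nonzero trace is
    fixed by [s] and can be scaled to 1. *)
Lemma tr_onto r : s r != r -> exists x, tr x = 1.
Proof.
move=> nr; suff [y y0] : exists y, tr y != 0.
  exists ((tr y)^-1 * y); rewrite tr_fixed ?mulVf //.
  by rewrite fmorphV s_tr.
have [h0|] := eqVneq (tr 1) 0; last by exists 1.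
have [h1|] := eqVneq (tr (r * 1)) 0; last by exists (r * 1).
exists (r * r * 1); apply/eqP => h2; have /eqP := tr_nondegenerate nr h0 h1 h2.
by rewrite oner_eq0.
Qed.

(** * The five kinds of planes *)

Variables (eps th : K).
Hypotheses (tr_eps : tr eps = 1) (th_neq : s th != th).

(** First coordinate of the cross product of the conjugate vectors of [eps] and [x]; the other two
    are its conjugates. Hence it is trace-orthogonal to both [x] and [eps]. *)
Definition cross x := s eps * s (s x) - s (s eps) * s x.

(* The coefficient [e] is [a + s b]: it vanishes exactly for the graphs on the cone. *)
Definition gab_map e b c d x : K * K * K :=
  (x, (e - s b) * s x + b * s (s x), c * s x + d * s (s x)).

(* The projection to [W] is the line [Tr(p w) = 0], parametrized by [w = x / p] with
   [tr x = 0], and [z |-> (z - s z, tr (eps * z))] identifies [K] with trace-zero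
   elements times the base field.  The plane meets [S] in the point [(0, p, mu)].
   Without the term [eps * mu * s x], planes with the same [p], [al] but different
   [mu] could share a line; with it, a common line would make [B * x + eps * s x]
   fixed by [s] for all trace-zero [x] and some [B], which forces [tr eps = 0]. *)
Definition greek_map p al mu b z : K * K * K :=
  ((z - s z) / p, p * (al * cross (z - s z) + tr (eps * z)),
   b * (z - s z) + eps * mu * s (z - s z) + tr (eps * z) * mu).

Definition square_map w a b y : K * K * K := (tr (w * y) * w, y, a * s y + b * s (s y)).

(** The factor of [g] vanishes only if both traces do, since [th] is not fixed; so distinct [g] give
    distinct shifts at every other [x]. *)
Definition pencil_shift g x := (tr (th * x) + tr x * th) * g.

(* All these planes pass through the point [(0, 0, r)] of [Z] and project to the point
   [1 / r] of [W], so that planes for different [r] can only meet inside [S]. *)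
Definition pencil_map r g x : K * K * K :=
  (tr x / r, r * (tr (th * x) * eps + (pencil_shift g x - s (pencil_shift g x))),
   r * (th * pencil_shift g x + tr (th * th * x))).

Definition vertex_map x : K * K * K := (0, 0, x).

Lemma fixlinear_gab e b c d : fixlinear (gab_map e b c d).
Proof.
by move=> k x y kE; apply: pair3_eq => /=; rewrite ?(rmorphM, rmorphD) ?kE; ring.
Qed.

Lemma trZ k x y a : s k = k -> tr (a * (k * x + y)) = k * tr (a * x) + tr (a * y).
Proof. by move=> kE; rewrite mulrDr trD mulrCA (tr_fixed (a * x) kE). Qed.

Lemma fixlinear_greek p al mu b : s al = al -> fixlinear (greek_map p al mu b).
Proof.
move=> alE k x y kE; rewrite /greek_map trZ //; apply: pair3_eq => /=;
  rewrite /cross ?(rmorphM, rmorphD, rmorphN) ?kE; ring.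
Qed.

Lemma fixlinear_square w a b : fixlinear (square_map w a b).
Proof.
by move=> k x y kE; rewrite /square_map trZ //; apply: pair3_eq => /=;
  rewrite ?(rmorphM, rmorphD, rmorphN) ?kE; ring.
Qed.

Lemma pencil_shift_linear g k x y : s k = k ->
  pencil_shift g (k * x + y) = k * pencil_shift g x + pencil_shift g y.
Proof. by move=> kE; rewrite /pencil_shift trZ // trD (tr_fixed x kE); ring. Qed.

Lemma fixlinear_pencil r g : fixlinear (pencil_map r g).
Proof.
move=> k x y kE; rewrite /pencil_map pencil_shift_linear // !trZ // trD (tr_fixed x kE).
by apply: pair3_eq => /=; rewrite ?(rmorphM, rmorphD) ?kE; ring.
Qed.

Lemma fixlinear_vertex : fixlinear vertex_map.
Proof. by move=> k x y kE; apply: pair3_eq => /=; ring. Qed.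

Lemma eps_neq0 : eps != 0.
Proof. by apply: contra_eq_neq tr_eps => ->; rewrite tr0 eq_sym oner_neq0. Qed.

Lemma tr_subs x : tr (x - s x) = 0.
Proof. by rewrite /tr !rmorphB s3; ring. Qed.

Lemma fixed_sub x : x - s x = 0 -> s x = x.
Proof. by move/eqP; rewrite subr_eq0 => /eqP/esym. Qed.

Lemma sub_tr_eps x : x - s x = 0 -> tr (eps * x) = 0 -> x = 0.
Proof. by move=> /fixed_sub xE; rewrite mulrC tr_fixed // tr_eps mulr1. Qed.

Lemma tr_cross x : tr (x * cross x) = 0.
Proof. by rewrite /tr /cross !(rmorphM, rmorphB) !s3; ring. Qed.

Lemma tr_cross2 x y : tr (x * cross y + y * cross x) = 0.
Proof. by rewrite /tr /cross !(rmorphM, rmorphD, rmorphN) !s3; ring. Qed.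

Lemma tr_eps_cross x : tr (eps * cross x) = 0.
Proof. by rewrite /tr /cross !(rmorphM, rmorphD, rmorphN) !s3; ring. Qed.

Lemma cross_eq0 x : tr x = 0 -> cross x = 0 -> x = 0.
Proof.
move=> x0 /eqP; rewrite subr_eq0 => /eqP h.
have /(proportionalP eps_neq0) kE : proportional eps x.
  by apply: proportional_s; rewrite /proportional h mulrC.
have xE : x = x / eps * eps by rewrite divfK ?eps_neq0.
by move: x0; rewrite xE tr_fixed // tr_eps mulr1 => ->; rewrite mul0r.
Qed.

Lemma trivker_gab e b c d : trivker (gab_map e b c d).
Proof. by move=> x []. Qed.

Lemma trivker_greek p al mu b : p != 0 -> trivker (greek_map p al mu b).
Proof.
move=> p0 z [/eqP]; rewrite mulf_eq0 invr_eq0 (negPf p0) orbF => /eqP x0.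
rewrite x0 => /eqP; rewrite /cross !rmorph0 !mulr0 subr0 mulr0 add0r mulf_eq0 (negPf p0).
by move=> /eqP t0 _; apply: sub_tr_eps.
Qed.

Lemma trivker_square w a b : trivker (square_map w a b).
Proof. by move=> y []. Qed.

Lemma pencil_y_eq0 r g x : r != 0 ->
  r * (tr (th * x) * eps + (pencil_shift g x - s (pencil_shift g x))) = 0 -> tr (th * x) = 0.
Proof.
move=> r0 /eqP; rewrite mulf_eq0 (negPf r0) /= => /eqP /(congr1 tr).
by rewrite trD tr_subs addr0 tr_fixed ?s_tr // tr_eps mulr1 tr0.
Qed.

Lemma pencil_shift_eq0 g x : tr x = 0 -> tr (th * x) = 0 -> pencil_shift g x = 0.
Proof. by rewrite /pencil_shift => -> ->; rewrite mul0r addr0 mul0r. Qed.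

Lemma trivker_pencil r g : r != 0 -> trivker (pencil_map r g).
Proof.
move=> r0 x [/eqP]; rewrite mulf_eq0 invr_eq0 (negPf r0) orbF => /eqP x0.
move=> /(pencil_y_eq0 r0) x1; rewrite pencil_shift_eq0 // mulr0 add0r => /eqP.
rewrite mulf_eq0 (negPf r0) => /eqP; exact: tr_nondegenerate.
Qed.

Lemma trivker_vertex : trivker vertex_map.
Proof. by move=> x []. Qed.

(** * Pairwise intersections of the planes *)

Lemma meets_gab_gab e b c d e' b' c' d' :
  (e, b, c, d) != (e', b', c', d') -> meets (gab_map e b c d) (gab_map e' b' c' d').
Proof.
move=> ne x1 x2 y1 y2 [<- h1 k1] [<- h2 k2].
have [//|/eqP nc] := eqVneq (x1 * s x2) (x2 * s x1); case/eqP: ne.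
have gab a1 b1 a2 b2 : a1 * s x1 + b1 * s (s x1) = a2 * s x1 + b2 * s (s x1) ->
    a1 * s x2 + b1 * s (s x2) = a2 * s x2 + b2 * s (s x2) -> a1 = a2 /\ b1 = b2.
  move=> u1 u2; have [||[/eqP aE /eqP bE]|//] := @gabidulin_ker (a1 - a2) (b1 - b2) x1 x2.
  - by apply/eqP; rewrite !mulrBl addrACA -opprD subr_eq0 u1.
  - by apply/eqP; rewrite !mulrBl addrACA -opprD subr_eq0 u2.
  by rewrite !subr_eq0 in aE bE; split; apply/eqP.
have [eE bE] := gab _ _ _ _ h1 h2; have [cE dE] := gab _ _ _ _ k1 k2.
by move: eE; rewrite bE cE dE => /addIr ->.
Qed.

(** The term [p * tr (eps * z')] contributes nothing because [z - s z] has trace zero. What remains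
    is alternating by [tr_cross] and [tr_cross2], so a Greek plane lies on the quadric cone. *)
Lemma greek_pairing p al mu b z z' : p != 0 -> s al = al ->
  tr ((greek_map p al mu b z).1.1 * (greek_map p al mu b z').1.2) =
    al * tr ((z - s z) * cross (z' - s z')).
Proof.
move=> p0 alE; rewrite /greek_map /= mulrA divfK // mulrDr trD mulrCA (tr_fixed _ alE).
by rewrite [_ * tr (eps * z')]mulrC (tr_fixed _ (s_tr _)) tr_subs mulr0 addr0.
Qed.

Lemma greek_quadric p al mu b z : p != 0 -> s al = al ->
  tr ((greek_map p al mu b z).1.1 * (greek_map p al mu b z).1.2) = 0.
Proof. by move=> p0 alE; rewrite greek_pairing // tr_cross mulr0. Qed.

Lemma greek_polar p al mu b z z' : p != 0 -> s al = al ->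
  tr ((greek_map p al mu b z).1.1 * (greek_map p al mu b z').1.2) +
  tr ((greek_map p al mu b z').1.1 * (greek_map p al mu b z).1.2) = 0.
Proof. by move=> p0 alE; rewrite !greek_pairing // -mulrDr -trD tr_cross2 mulr0. Qed.

(** On the graph the form Tr(w y) becomes [tr (e * x * s x)], and a common line would be totally
    singular for it, against [quad_form_line]. *)
Lemma meets_gab_greek e b c d p al mu b' : e != 0 -> p != 0 -> s al = al ->
  meets (gab_map e b c d) (greek_map p al mu b').
Proof.
move=> e0 p0 alE x1 x2 z1 z2 u1 u2.
have := greek_quadric mu b' z1 p0 alE; have := greek_quadric mu b' z2 p0 alE.
have := greek_polar mu b' z1 z2 p0 alE; rewrite -{}u1 -{}u2 /gab_map /= => q12 q2 q1.
have [|||e00|//] := @quad_form_line e x1 x2; last by rewrite e00 eqxx in e0.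
- by rewrite -q1 /tr !(rmorphM, rmorphD, rmorphN) !s3; ring.
- by rewrite -q2 /tr !(rmorphM, rmorphD, rmorphN) !s3; ring.
by rewrite -q12 /tr !(rmorphM, rmorphD, rmorphN) !s3; ring.
Qed.

(** A graph over W is determined by its W-part, and the W-part of the other plane is at most the
    single point [w]. *)
Lemma meets_gab_square e b c d w a' b' : meets (gab_map e b c d) (square_map w a' b').
Proof. by move=> x1 x2 y1 y2 [-> _ _] [-> _ _]; apply: proportional_fixed; apply: s_tr. Qed.

Lemma meets_gab_pencil e b c d r g : meets (gab_map e b c d) (pencil_map r g).
Proof. by move=> x1 x2 y1 y2 [-> _ _] [-> _ _]; apply: proportional_fixed; apply: s_tr. Qed.

Lemma meets_gab_vertex e b c d : meets (gab_map e b c d) vertex_map.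
Proof. by move=> x1 x2 y1 y2 [-> _ _] [-> _ _]. Qed.

Lemma meets_greek_vertex p al mu b : p != 0 -> meets (greek_map p al mu b) vertex_map.
Proof.
move=> p0 z1 z2 y1 y2 [e1 _ _] [e2 _ _].
have fx z : (z - s z) / p = 0 -> s z = z.
  by move/eqP; rewrite mulf_eq0 invr_eq0 (negPf p0) orbF => /eqP/fixed_sub.
by apply: fixed_proportional; apply: fx.
Qed.

Lemma meets_square_vertex w a b : meets (square_map w a b) vertex_map.
Proof. by move=> y1 y2 z1 z2 [_ -> _] [_ -> _]. Qed.

Lemma meets_pencil_vertex r g : r != 0 -> meets (pencil_map r g) vertex_map.
Proof.
move=> r0 x1 x2 y1 y2 [t1 u1 _] [t2 u2 _].
have t0 x : tr x / r = 0 -> tr x = 0.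
  by move/eqP; rewrite mulf_eq0 invr_eq0 (negPf r0) orbF => /eqP.
apply: (tr_proportional th_neq); rewrite ?[_ * th]mulrC ?(pencil_y_eq0 r0 u1)
  ?(pencil_y_eq0 r0 u2) //;
  exact: t0.
Qed.

(** On a square plane Tr(w y) takes the value [tr (w * y) ^+ 2], so a vector also on the cone has
    W-part zero; on the Greek plane this forces [z] to be fixed. *)
Lemma meets_greek_square p al mu b w a' b' : p != 0 -> s al = al ->
  meets (greek_map p al mu b) (square_map w a' b').
Proof.
move=> p0 alE z1 z2 y1 y2 e1 e2.
have fx z y : greek_map p al mu b z = square_map w a' b' y -> s z = z.
  move=> ez; have := greek_quadric mu b z p0 alE; rewrite ez /= -mulrA tr_fixed ?s_tr //.
  move/eqP; rewrite mulf_eq0 orbb => /eqP wy; case: ez; rewrite wy mul0r => /eqP.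
  by rewrite mulf_eq0 invr_eq0 (negPf p0) orbF => /eqP/fixed_sub.
by apply: fixed_proportional; [apply: fx e1 | apply: fx e2].
Qed.

Lemma meets_square_square_same w a b a' b' : (a, b) != (a', b') ->
  meets (square_map w a b) (square_map w a' b').
Proof.
move=> ne y1 y2 z1 z2 [_ <- h1] [_ <- h2].
have [||[/eqP aE /eqP bE]|//] := @gabidulin_ker (a - a') (b - b') y1 y2.
- by apply/eqP; rewrite !mulrBl addrACA -opprD subr_eq0 h1.
- by apply/eqP; rewrite !mulrBl addrACA -opprD subr_eq0 h2.
by case/eqP: ne; rewrite !subr_eq0 in aE bE; rewrite (eqP aE) (eqP bE).
Qed.

Lemma ratio_neq x y : x != 0 -> ~ proportional x y -> s (y / x) != y / x.
Proof.
move=> x0 nxy; apply/eqP => h; apply: nxy; apply: (scaled_proportional h).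
by rewrite divfK.
Qed.

Lemma fixed_indep x y a b : ~ proportional x y -> s a = a -> s b = b ->
  a * x = b * y -> a = 0 /\ b = 0.
Proof.
move=> nxy aE bE h; have h' : a * s x = b * s y by rewrite -aE -bE -!rmorphM h.
have d0 : x * s y - y * s x != 0 by rewrite subr_eq0; apply/eqP.
split; apply: (mulIf d0); rewrite mul0r.
  by transitivity (a * x * s y - y * (a * s x)); [ring | rewrite h h'; ring].
by transitivity (x * (b * s y) - b * y * s x); [ring | rewrite -h -h'; ring].
Qed.

Lemma meets_square_square_diff (w w' : K) a b a' b' : w != 0 -> ~ proportional w w' ->
  meets (square_map w a b) (square_map w' a' b').
Proof.
move=> w0 nc y1 y2 z1 z2 [h1 e1 _] [h2 e2 _]; subst z1 z2.
have [u1 v1] := fixed_indep nc (s_tr _) (s_tr _) h1.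
have [u2 v2] := fixed_indep nc (s_tr _) (s_tr _) h2.
apply: (@proportional_mul2l w) => //; apply: (tr_proportional (ratio_neq w0 nc)) => //.
  by rewrite mulrC mulrA divfK ?v1 //.
by rewrite mulrC mulrA divfK ?v2 //.
Qed.

Lemma tr_functional a k x y : s k = k -> tr (a * (y - k * x)) = tr (a * y) - k * tr (a * x).
Proof. by move=> kE; rewrite addrC -mulNr trZ ?rmorphN ?kE // addrC mulNr. Qed.

Lemma pencil_third_eq0 r g x : r != 0 -> tr x = 0 -> tr (th * x) = 0 ->
  r * (th * pencil_shift g x + tr (th * th * x)) = 0 -> x = 0.
Proof.
move=> r0 x0 x1; rewrite pencil_shift_eq0 // mulr0 add0r => /eqP.
by rewrite mulf_eq0 (negPf r0) => /eqP; apply: tr_nondegenerate.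
Qed.

Lemma meets_pencil_square r g w a b : r != 0 -> meets (pencil_map r g) (square_map w a b).
Proof.
move=> r0; apply: (@meets_functional _ _ (fun x => tr (th * x))).
- exact: fixlinear_pencil.
- exact: fixlinear_square.
- by move=> *; apply: tr_functional.
- move=> x y [e1 e2 e3] x1.
  have e2' : y = r * (pencil_shift g x - s (pencil_shift g x)) by rewrite -e2 x1 mul0r add0r.
  suff x0 : tr x = 0.
    apply: (@pencil_third_eq0 r g) => //.
    by rewrite e3 e2' pencil_shift_eq0 // rmorph0 subrr mulr0 !rmorph0 !mulr0 addr0.
  have [//|x0] := eqVneq (tr x) 0.
  (* If [tr x] were nonzero, equal W-parts would make [w] a fixed multiple of [r^-1]; but [e2']
     gives [y / r] trace zero, which contradicts [wy0]. *)
  have wy0 : tr (w * y) != 0.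
    apply: contra_neq x0 => wy; move: e1; rewrite wy mul0r => /eqP.
    by rewrite mulf_eq0 invr_eq0 (negPf r0) orbF => /eqP.
  have [k kE wE] : exists2 k, s k = k & w = k / r.
    exists (tr x / tr (w * y)); first by rewrite fmorph_div !s_tr.
    by apply: (mulfI wy0); rewrite -e1; field; rewrite r0.
  have /eqP[] := wy0; rewrite wE e2' mulrA divfK //.
  by rewrite tr_fixed // tr_subs mulr0.
- by move=> x1 x2 y1 y2 _ _; apply: fixed_proportional; apply: s_tr.
Qed.

(** Independence acts twice: the W-points differ, so common vectors lie in S; the points of Z
    differ, so no common vector lies in Z. *)
Lemma meets_pencil_pencil_diff (r r' : K) g g' : r != 0 -> r' != 0 -> ~ proportional r r' ->
  meets (pencil_map r g) (pencil_map r' g').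
Proof.
move=> r0 r0' nc; apply: (@meets_functional _ _ (fun x => tr (th * x))).
- exact: fixlinear_pencil.
- exact: fixlinear_pencil.
- by move=> *; apply: tr_functional.
- move=> x y [e1 e2 e3] x1.
  have {e1} e1 : tr x * r' = tr y * r.
    by move/eqP: e1; rewrite eqr_div // => /eqP.
  have nc' : ~ proportional r' r by move=> /proportional_sym.
  have [x0 y0] := fixed_indep nc' (s_tr _) (s_tr _) e1.
  have y1 : tr (th * y) = 0.
    apply: (@pencil_y_eq0 r' g') => //.
    by rewrite -e2 x1 mul0r add0r pencil_shift_eq0 // rmorph0 subrr mulr0.
  apply: (tr_nondegenerate th_neq) => //.
  move: e3; rewrite !pencil_shift_eq0 // !mulr0 !add0r mulrC [r' * _]mulrC => e3.
  by have [] := fixed_indep nc (s_tr _) (s_tr _) e3.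
- by move=> x1 x2 y1 y2 _ _; apply: fixed_proportional; apply: s_tr.
Qed.

Lemma meets_pencil_pencil_same r g g' : r != 0 -> g != g' ->
  meets (pencil_map r g) (pencil_map r g').
Proof.
move=> r0 ng.
have key x y : pencil_map r g x = pencil_map r g' y -> tr x = 0 /\ tr (th * x) = 0.
  case=> /(divIf r0) e0 /(mulfI r0) e1 /(mulfI r0) e2.
  have e3 : tr (th * x) = tr (th * y).
    have := congr1 tr e1; rewrite trD tr_subs addr0.
    rewrite [in RHS]trD tr_subs addr0 !(tr_fixed _ (s_tr _)).
    by rewrite tr_eps !mulr1.
  have c0 : pencil_shift g x - pencil_shift g' y = (tr (th * x) + tr x * th) * (g - g').
    by rewrite /pencil_shift -e3 -e0; ring.
  (* The middle coordinates make [H] fixed by [s] and the last ones make [th * H] fixed; as [th] is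
     not fixed, [H] is zero. *)
  set H := pencil_shift g x - pencil_shift g' y in c0.
  have HF : s H = H.
    move/eqP: e1; rewrite e3 (inj_eq (addrI _)) => /eqP e1.
    apply/esym/eqP; rewrite -subr_eq0 /H rmorphB; apply/eqP.
    by transitivity ((pencil_shift g x - s (pencil_shift g x)) -
        (pencil_shift g' y - s (pencil_shift g' y)));
      [ring | rewrite e1 subrr].
  have thH : s (th * H) = th * H.
    have -> : th * H = tr (th * th * y) - tr (th * th * x).
      apply/eqP; rewrite -subr_eq0; apply/eqP.
      transitivity ((th * pencil_shift g x + tr (th * th * x)) -
        (th * pencil_shift g' y + tr (th * th * y))).
        by rewrite /H; ring.
      by rewrite e2 subrr.
    by rewrite fixedB // s_tr.
  have H0 : H = 0.
    have [//|H0] := eqVneq H 0; have /eqP[] := th_neq; apply: (mulIf H0).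
    by rewrite -{1}HF -rmorphM thH.
  move: c0; rewrite H0 => /esym/eqP; rewrite mulf_eq0 subr_eq0 (negPf ng) orbF => /eqP q.
  have tx : tr x = 0.
    have [//|x0] := eqVneq (tr x) 0; have /eqP[] := th_neq.
    have -> : th = - tr (th * x) / tr x.
      by apply: (mulIf x0); rewrite divfK // mulrC; apply/eqP; rewrite -addr_eq0 addrC q.
    by rewrite fmorph_div rmorphN !s_tr.
  by move: q; rewrite tx mul0r addr0.
move=> x1 x2 y1 y2 /key [a1 b1] /key [a2 b2].
by apply: (tr_proportional th_neq); rewrite // mulrC.
Qed.

(** On a pencil plane Tr(w y) is the product of [tr x] and [tr (th * x)], so a common line would be
    one of two lines. The first lies in S, which the Greek plane meets in a point; the second passes
    through the vertex point, excluded by [fx4]. *)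
Lemma meets_greek_pencil p al mu b r g : p != 0 -> s al = al -> r != 0 ->
  meets (greek_map p al mu b) (pencil_map r g).
Proof.
move=> p0 alE r0 z1 z2 x1 x2 e1 e2.
have w_y x x' : tr ((pencil_map r g x).1.1 * (pencil_map r g x').1.2) = tr x * tr (th * x').
  rewrite /pencil_map /= mulrA divfK // tr_fixed ?s_tr // trD tr_subs addr0.
  by rewrite tr_fixed ?s_tr // tr_eps mulr1.
have q1 := greek_quadric mu b z1 p0 alE; have q2 := greek_quadric mu b z2 p0 alE.
have q12 := greek_polar mu b z1 z2 p0 alE.
rewrite e1 w_y in q1; rewrite e2 w_y in q2; rewrite e1 e2 !w_y in q12.
have fx z x : greek_map p al mu b z = pencil_map r g x -> tr x = 0 -> s z = z.
  move=> [+ _ _] x0; rewrite x0 mul0r => /eqP.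
  by rewrite mulf_eq0 invr_eq0 (negPf p0) orbF => /eqP/fixed_sub.
have l2 : fixlinear (greek_map p al mu b) by apply: fixlinear_greek.
have l4 := @fixlinear_pencil r g.
have fx4 z x : greek_map p al mu b z = pencil_map r g x -> tr x = 0 ->
    tr (th * x) = 0 -> x = 0.
  move=> ez x0 t0; have zF := fx _ _ ez x0.
  case: ez; rewrite zF subrr /cross !rmorph0 !mulr0 subr0 mulr0 !add0r.
  move=> _; rewrite t0 mul0r add0r pencil_shift_eq0 // rmorph0 subr0 mulr0 => /eqP.
  rewrite mulf_eq0 (negPf p0) => /eqP tz; rewrite tz mul0r => /esym h.
  by apply: (@pencil_third_eq0 r g) => //; rewrite pencil_shift_eq0.
have main z z' x x' : greek_map p al mu b z = pencil_map r g x ->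
    greek_map p al mu b z' = pencil_map r g x' ->
    tr x != 0 -> tr (th * x) = 0 -> tr (th * x') = 0 -> proportional z z'.
  move=> ez ez' x0 t t'.
  apply: (proportional_transfer l2 l4 (@trivker_greek p al mu b p0) ez ez').
  set k := tr x' / tr x; have kE : s k = k by rewrite fmorph_div !s_tr.
  apply: (scaled_proportional kE); apply/eqP; rewrite -subr_eq0; apply/eqP.
  apply: (@fx4 (z' - k * z)); first by rewrite !fixlinear_comb // ez ez'.
    by rewrite -[x' - _]mul1r tr_functional // !mul1r /k divfK // subrr.
  by rewrite tr_functional // t t' mulr0 subr0.
have [x10|x10] := eqVneq (tr x1) 0; last first.
  have t1 : tr (th * x1) = 0.
    by move/eqP: q1; rewrite mulf_eq0 (negPf x10) => /eqP.
  apply: (main _ _ _ _ e1 e2) => //.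
  by move/eqP: q12; rewrite t1 mulr0 addr0 mulf_eq0 (negPf x10) => /eqP.
have [x20|x20] := eqVneq (tr x2) 0.
  by apply: fixed_proportional; [apply: fx e1 _ | apply: fx e2 _].
have t2 : tr (th * x2) = 0.
  by move/eqP: q2; rewrite mulf_eq0 (negPf x20) => /eqP.
apply/proportional_sym/(main _ _ _ _ e2 e1) => //.
by move/eqP: q12; rewrite t2 mulr0 add0r mulf_eq0 (negPf x20) => /eqP.
Qed.

Lemma sub_functional k x y : s k = k ->
  (y - k * x) - s (y - k * x) = (y - s y) - k * (x - s x).
Proof. by move=> kE; rewrite rmorphB rmorphM kE; ring. Qed.

(** The W-parts lie on two different lines of W, which share one point, and the planes meet S in
    different points. *)
Lemma meets_greek_greek_diff (p p' : K) al mu b al' mu' b' : p != 0 -> p' != 0 ->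
  s al = al -> s al' = al' -> ~ proportional p p' ->
  meets (greek_map p al mu b) (greek_map p' al' mu' b').
Proof.
move=> p0 p0' alE alE' nc; apply: (@meets_functional _ _ (fun z => z - s z)).
- exact: fixlinear_greek.
- exact: fixlinear_greek.
- by move=> *; apply: sub_functional.
- move=> z y [e1 e2 _] z0; apply: sub_tr_eps => //.
  have y0 : y - s y = 0.
    by move/esym/eqP: e1; rewrite z0 mul0r mulf_eq0 invr_eq0 (negPf p0') orbF => /eqP.
  move: e2; rewrite z0 y0 /cross !rmorph0 !mulr0 subr0 !mulr0 !add0r mulrC [p' * _]mulrC.
  by move=> /(fixed_indep nc (s_tr _) (s_tr _)) [].
- have key z y : greek_map p al mu b z = greek_map p' al' mu' b' y ->
      tr ((z - s z) * (p' / p)) = 0.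
    move=> [e1 _ _]; have -> : (z - s z) * (p' / p) = y - s y.
      by rewrite mulrCA e1 mulrCA divff // mulr1.
    exact: tr_subs.
  move=> x1 x2 y1 y2 /key h1 /key h2.
  by apply: (tr_proportional (ratio_neq p0 nc)); rewrite ?tr_subs.
Qed.

Lemma meets_greek_greek_same (p al mu b al' mu' b' : K) : p != 0 -> s al = al -> s al' = al' ->
  (al, mu, b) != (al', mu', b') -> meets (greek_map p al mu b) (greek_map p al' mu' b').
Proof.
move=> p0 alE alE' ne.
have reduce z y : greek_map p al mu b z = greek_map p al' mu' b' y -> y - s y = z - s z /\
    (al - al') * cross (z - s z) = tr (eps * y) - tr (eps * z).
  move=> [/(divIf p0) <- /(mulfI p0) e _]; split=> //.
  move: (cross _) e => c e; apply/eqP; rewrite -subr_eq0; apply/eqP.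
  transitivity ((al * c + tr (eps * z)) - (al' * c + tr (eps * y))); first by ring.
  by rewrite e subrr.
have teq z y : greek_map p al mu b z = greek_map p al' mu' b' y -> tr (eps * y) = tr (eps * z).
  move=> /reduce [_ h]; have DE := fixedB (s_tr (eps * y)) (s_tr (eps * z)).
  apply/eqP; rewrite -subr_eq0; move: (tr _ - tr _) h DE => D h DE.
  (* Pairing with [eps] kills the [cross] term and, as [tr eps = 1], returns [D] itself. *)
  have := congr1 (fun u => tr (eps * u)) h; rewrite /= mulrCA.
  rewrite (tr_fixed _ (fixedB alE alE')) tr_eps_cross mulr0 mulrC (tr_fixed _ DE).
  by rewrite tr_eps mulr1 => <-.
have [al_eq|al_neq] := eqVneq al al'; last first.
  have fz z y : greek_map p al mu b z = greek_map p al' mu' b' y -> s z = z.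
    move=> e; have [_] := reduce _ _ e; rewrite (teq _ _ e) subrr => /eqP.
    rewrite mulf_eq0 subr_eq0 (negPf al_neq) => /eqP /(cross_eq0 (tr_subs _)).
    exact: fixed_sub.
  by move=> z1 z2 y1 y2 /fz h1 /fz h2; apply: fixed_proportional.
have third z y : greek_map p al mu b z = greek_map p al' mu' b' y ->
    (b - b') * (z - s z) + eps * (mu - mu') * s (z - s z) + tr (eps * z) * (mu - mu') = 0.
  move=> e; have [xE _] := reduce _ _ e; have tE := teq _ _ e.
  case: e => _ _; rewrite xE tE => e.
  set L := LHS in e; set R := RHS in e; transitivity (L - R); last by rewrite e subrr.
  by rewrite /L /R; ring.
have [mu_eq|mu_neq] := eqVneq mu mu'.
  have nb : b - b' != 0.
    by rewrite subr_eq0; apply: contra_neq ne => ->; rewrite al_eq mu_eq.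
  have fz z y : greek_map p al mu b z = greek_map p al' mu' b' y -> s z = z.
    move=> /third; rewrite mu_eq subrr !mulr0 mul0r !addr0 => /eqP.
    by rewrite mulf_eq0 (negPf nb) => /eqP; apply: fixed_sub.
  by move=> z1 z2 y1 y2 /fz h1 /fz h2; apply: fixed_proportional.
have m0 : mu - mu' != 0 by rewrite subr_eq0.
pose B := (b - b') / (mu - mu').
have {}third z y : greek_map p al mu b z = greek_map p al' mu' b' y ->
    B * (z - s z) + eps * s (z - s z) = - tr (eps * z).
  move=> /third h; apply: (mulIf m0); apply/eqP; rewrite -subr_eq0 -h; apply/eqP.
  by rewrite /B; field.
clearbody B.
apply: (@meets_functional _ _ (fun z => z - s z)).
- exact: fixlinear_greek.
- exact: fixlinear_greek.
- by move=> *; apply: sub_functional.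
- move=> z y /third + z0; rewrite z0 rmorph0 !mulr0 addr0 => /esym/eqP.
  by rewrite oppr_eq0 => /eqP; apply: sub_tr_eps.
(* By [third] the left side there is fixed by [s]. Eliminating [s (s x)] through [tr x = 0], for
   [x = z - s z], and applying [s] once more gives the shape needed for [gabidulin_ker]. *)
have gab z y : greek_map p al mu b z = greek_map p al' mu' b' y ->
    s (B + s eps) * s (z - s z) + s (eps - s B + s eps) * s (s (z - s z)) = 0.
  move=> /third h; have := congr1 s h; rewrite [RHS]rmorphN s_tr -h.
  have ssx : s (s (z - s z)) = - (z - s z) - s (z - s z).
    by rewrite -[RHS]addr0 -(tr_subs z) /tr; ring.
  move: (z - s z) ssx => x ssx h'; rewrite rmorphD !rmorphM ssx in h'.
  transitivity (s ((B + s eps) * x + (eps - s B + s eps) * s x)); first by ring.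
  suff -> : (B + s eps) * x + (eps - s B + s eps) * s x = 0 by rewrite rmorph0.
  apply/eqP; rewrite -oppr_eq0; apply/eqP.
  transitivity (s B * s x + s eps * (- x - s x) - (B * x + eps * s x)); first by ring.
  by rewrite h' subrr.
(* If both coefficients vanish, then [B = - s eps] and the second one reads [tr eps = 0], contrary
   to [tr_eps]. *)
move=> z1 z2 y1 y2 /gab h1 /gab h2; have [[/eqP u /eqP v]|//] := gabidulin_ker h1 h2.
move: u v; rewrite !fmorph_eq0 addr_eq0 => /eqP -> /eqP.
rewrite rmorphN opprK => h; have := tr_eps; rewrite /tr addrAC h => /esym/eqP.
by rewrite oner_eq0.
Qed.
End CyclicCubic.

(** * From parametrizations to vector subspaces *)

Lemma linfunE (F : fieldType) (U V : vectType F) (f : U -> V) : linear f -> linfun f =1 f.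
Proof.
move=> lf; pose fL : {linear U -> V} := HB.pack f (GRing.isLinear.Build F U V *:%R f lf).
exact: (lfunE fL).
Qed.

Section Planes.
Variables (F : fieldType) (K : fieldExtType F) (s : {rmorphism K -> K}).
Hypothesis s_alg : forall k : F, s k%:A = k%:A.
Hypothesis s_fixed : forall x, s x = x -> exists k : F, x = k%:A.
Local Notation V := (K * K * K)%type.

Definition plane (f : K -> V) : {vspace V} := limg (linfun f).

Lemma sc_alg (k : F) (v : V) : sc k%:A v = k *: v.
Proof. by case: v => [[a b] c]; rewrite /sc /= !mulr_algl. Qed.

Section Image.
Variable f : K -> V.
Hypothesis lf : fixlinear s f.

Fact fixlinear_linear : linear f.
Proof. by move=> k x y; rewrite -mulr_algl lf // sc_alg. Qed.

Lemma planeP v : reflect (exists x, v = f x) (v \in plane f).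
Proof.
apply: (iffP memv_imgP) => [[x _ ->]|[x ->]];
  first by exists x; rewrite (linfunE fixlinear_linear).
by exists x; rewrite ?memvf ?(linfunE fixlinear_linear).
Qed.

Lemma dim_plane : trivker f -> \dim (plane f) = \dim {:K}.
Proof.
move=> kf; apply: limg_dim_eq; rewrite capfv; apply/eqP/lker0P => x y.
move=> /eqP; rewrite -subr_eq0 -raddfB /= (linfunE fixlinear_linear) => /eqP/kf/eqP.
by rewrite subr_eq0 => /eqP.
Qed.
End Image.

(** Any nonzero common vector [f x1] spans the intersection: for another one [f x2], the quotient
    [x2 / x1] is fixed by [s], hence a scalar. *)
Lemma plane_meet f g : fixlinear s f -> fixlinear s g -> meets s f g ->
  (\dim (plane f :&: plane g) <= 1)%N.
Proof.
move=> lf lg m; have [->|U0] := eqVneq (plane f :&: plane g)%VS 0%VS; first by rewrite dimv0.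
rewrite -vpick0 in U0; set u := vpick _ in U0.
suff : (plane f :&: plane g <= <[u]>)%VS by move/dimvS; rewrite dim_vline U0.
have := memv_pick (plane f :&: plane g); rewrite -/u memv_cap.
move=> /andP[/(planeP lf) [x1 e1] /(planeP lg) [y1 e1']].
apply/subvP => v; rewrite memv_cap => /andP[/(planeP lf) [x2 e2] /(planeP lg) [y2 e2']].
have x10 : x1 != 0.
  by apply: contra_neq U0 => x10; rewrite e1 x10 (fixlinear0 lf).
have c : proportional s x1 x2 by apply: (m _ _ y1 y2); rewrite -?e1 -?e2.
have [k kE] := s_fixed (proportionalP x10 c).
apply/vlineP; exists k; rewrite e1 e2 -[x2](divfK x10) kE -sc_alg.
by rewrite -[k%:A * x1]addr0 lf // (fixlinear0 lf) addr0.
Qed.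
End Planes.

(** * Coordinates, the cubic extension and its Frobenius map *)

Lemma vect_iso_rV (F : fieldType) (V : vectType F) n :
  \dim {:V} = n -> exists g : 'Hom(V, 'rV[F]_n), lker g == 0%VS.
Proof.
move=> <-; exists (linfun (passmx.rVof (vbasis {:V}))).
apply/lker0P => x y; rewrite !(linfunE (@passmx.rVof_linear _ _ _)).
exact: (can_inj (passmx.rVofK (vbasisP _))).
Qed.

Lemma cubic_extension (F : finFieldType) : exists L : fieldExtType F, \dim {:L} = 3%N.
Proof.
pose h (t : F) := t ^+ 3 - t.
(* [h 0 = h 1], so [h] is not injective, hence not surjective. *)
have [c hc] : exists c, forall t, h t != c.
  have : ~~ injectiveb h.
    apply/negP => /injectiveP /(_ 0 1); rewrite /h expr1n expr0n !subrr => /(_ erefl) /eqP.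
    by rewrite eq_sym oner_eq0.
  move=> ni; suff /existsP[c /forallP hc] : [exists c, forall t, h t != c] by exists c.
  apply: contraR ni; rewrite negb_exists => /forallP hs.
  suff /image_injP hi : #|image h F| == #|F| by apply/injectiveP => x y; apply: hi.
  rewrite eqn_leq leq_image_card /=.
  apply: subset_leq_card; apply/subsetP => c _.
  have := hs c; rewrite negb_forall => /existsP [t]; rewrite negbK => /eqP <-.
  exact: codom_f.
pose p : {poly F} := 'X^3 - 'X - c%:P.
have sp : size p = 4%N.
  rewrite /p -addrA size_polyDl ?size_polyXn // -opprD size_polyN.
  apply: leq_ltn_trans (size_polyD _ _) _; rewrite size_polyX gtn_max /=.
  by apply: leq_ltn_trans (size_polyC_leq1 _) _.
have irr : irreducible_poly p.
  apply: cubic_irreducible => [|x]; first by rewrite sp.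
  by rewrite rootE /p !hornerE subr_eq0; apply: hc.
by have [L dL _] := irredp_FAdjoin irr; exists L; rewrite dL sp.
Qed.

Lemma frobenius_rmorphism (F : finFieldType) (L : fieldExtType F) :
  exists s : {rmorphism L -> L}, forall x, s x = x ^+ #|F|.
Proof.
pose f (x : L) := x ^+ #|F|; have [p pr_p pcharFp] := finPcharP F.
have pcharLp : p \in [pchar L] by rewrite pchar_lalg.
have qn : [pchar L].-nat #|F|.
  rewrite (card_pprimeChar pcharFp) (eq_pnat _ (pcharf_eq pcharLp)).
  by rewrite pnatX pnat_id.
have fB : zmod_morphism f.
  by move=> x y; rewrite /f; apply/eqP; rewrite eq_sym subr_eq -exprDn_pchar // subrK.
have fM : monoid_morphism f.
  by rewrite /f; split=> [|x y]; rewrite ?expr1n ?exprMn.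
pose s : {rmorphism L -> L} := HB.pack f
  (GRing.isZmodMorphism.Build _ _ f fB) (GRing.isMonoidMorphism.Build _ _ f fM).
by exists s.
Qed.

Section CubicFrobenius.
Variables (F : finFieldType) (L : fieldExtType F) (s : {rmorphism L -> L}).
Hypotheses (dL : \dim {:L} = 3%N) (sE : forall x, s x = x ^+ #|F|).

Lemma frobenius_cube x : s (s (s x)) = x.
Proof.
have := Fermat's_little_theorem {:L}%AS x; rewrite memvf dL => /esym/eqP xE.
by rewrite !sE -!exprM -[RHS]xE !expnS expn0 muln1 mulnA.
Qed.

Lemma frobenius_fixed x : s x = x -> exists k : F, x = k%:A.
Proof.
rewrite sE => xE; apply/vlineP; have := Fermat's_little_theorem 1%AS x.
by rewrite dimv1 expn1 xE eqxx.
Qed.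

Lemma frobenius_alg (k : F) : s k%:A = k%:A.
Proof. by rewrite sE -in_algE -rmorphXn expf_card. Qed.

Lemma not_frobenius_fixed : exists x, s x != x.
Proof.
have [x _ nx] : exists2 x, x \in {:L}%VS & x \notin 1%VS.
  apply/subvPn; apply/negP => /dimvS; by rewrite dL dimv1.
exists x; apply: contraNneq nx => /frobenius_fixed [k ->].
by rewrite memvZ // memv_line.
Qed.
End CubicFrobenius.

(** * The indexed family of planes and its size *)

Section Family.
Variables (F : finFieldType) (L : fieldExtType F) (s : {rmorphism L -> L}).
Hypotheses (s3 : forall x, s (s (s x)) = x) (s_alg : forall k : F, s k%:A = k%:A).
Hypothesis s_fixed : forall x, s x = x -> exists k : F, x = k%:A.
Variables (eps th : L).
Hypotheses (tr_eps : tr s eps = 1) (th_neq : s th != th).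
Local Notation K := (finvect_type L).

Definition comb3 (a b c : F) : L := a%:A + b%:A * th + c%:A * (th * th).

(** A polynomial of degree at most 2 with three distinct roots, the conjugates of [th], is zero;
    [k1] and [k2] are its divided differences. *)
Lemma comb3_eq0 a b c : comb3 a b c = 0 -> [/\ a = 0, b = 0 & c = 0].
Proof.
rewrite /comb3 => h0; have [nr1 nr2] := conj_neq s3 th_neq.
have h1 := congr1 s h0; rewrite !(rmorphD, rmorphM) rmorph0 !s_alg in h1.
have h2 := congr1 s h1; rewrite !(rmorphD, rmorphM) rmorph0 !s_alg in h2.
have alg0 (k : F) : k%:A = 0 :> L -> k = 0.
  by move/eqP; rewrite scaler_eq0 oner_eq0 orbF => /eqP.
have d1 : s th - th != 0 by rewrite subr_eq0.
have d2 : s (s th) - s th != 0 by rewrite subr_eq0.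
have d3 : s (s th) - th != 0 by rewrite subr_eq0.
have k1 : b%:A + c%:A * (s th + th) = 0 :> L.
  apply: (mulIf d1); rewrite mul0r -[RHS](subrr 0) -{1}h1 -{1}h0; ring.
have k2 : b%:A + c%:A * (s (s th) + s th) = 0 :> L.
  apply: (mulIf d2); rewrite mul0r -[RHS](subrr 0) -{1}h2 -{1}h1; ring.
have c0 : c = 0.
  by apply/alg0/(mulIf d3); rewrite mul0r -[RHS](subrr 0) -{1}k2 -{1}k1; ring.
have b0 : b = 0 by apply: alg0; rewrite -k1 c0 scale0r mul0r addr0.
split=> //; apply: alg0; rewrite -h0 b0 c0 scale0r; ring.
Qed.

(* Representatives [(1, a, b)], [(0, 1, a)], [(0, 0, 1)] of the points of PG(2,q). *)
Definition point : Type := option (F + F * F).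

Definition pcoord (i : point) : F * F * F :=
  match i with
  | None => (0, 0, 1)
  | Some (inl a) => (0, 1, a)
  | Some (inr ab) => (1, ab.1, ab.2)
  end.

Definition pvec (i : point) : L := comb3 (pcoord i).1.1 (pcoord i).1.2 (pcoord i).2.

Lemma pvec_neq0 i : pvec i != 0.
Proof.
apply/eqP => /comb3_eq0 []; case: i => [[a|[a b]]|] /=.
- by move=> _ /eqP; rewrite oner_eq0.
- by move=> /eqP; rewrite oner_eq0.
- by move=> _ _ /eqP; rewrite oner_eq0.
Qed.

Lemma pvec_proportional i j : proportional s (pvec i) (pvec j) -> i = j.
Proof.
move=> /(proportionalP (pvec_neq0 i)) /s_fixed [k kE].
have : comb3 ((pcoord j).1.1 - k * (pcoord i).1.1)
    ((pcoord j).1.2 - k * (pcoord i).1.2) ((pcoord j).2 - k * (pcoord i).2) = 0.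
  have : pvec j - k%:A * pvec i = 0 by rewrite -kE divfK ?pvec_neq0 // subrr.
  move=> <-; rewrite /pvec /comb3 -!in_algE !rmorphB !rmorphM; ring.
move=> /comb3_eq0 [/subr0_eq + /subr0_eq + /subr0_eq].
have F1 : 1 <> 0 :> F by apply/eqP; rewrite oner_eq0.
case: i {kE} => [[a|[a b]]|]; case: j => [[a'|[a' b']]|] //=; rewrite ?mulr0 ?mulr1 //.
- by move=> _ <- ->; rewrite mul1r.
- by move=> _ <-; rewrite mul0r.
- by move=> <-; rewrite mul0r.
- by move=> <- -> ->; rewrite !mul1r.
- by move=> <- _; rewrite mul0r.
Qed.

(** The summands have (q^3 - 1) q^9, (q^2 + q + 1) q^7, (q^2 + q + 1) q^6, (q^2 + q) q^3 and 1
    elements; the pencils run over the points other than [None]. *)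
Definition index : Type :=
  {e : K | e != 0} * K * K * K + point * F * K * K + point * K * K +
  (F + F * F) * K + unit.

Definition member (i : index) : L -> L * L * L :=
  match i with
  | inl (inl (inl (inl (e, b, c, d)))) => gab_map s (val e) b c d
  | inl (inl (inl (inr (p, al, mu, b)))) => greek_map s eps (pvec p) al%:A mu b
  | inl (inl (inr (w, a, b))) => square_map s (pvec w) a b
  | inl (inr (r, g)) => pencil_map s eps th (pvec (Some r)) g
  | inr _ => @vertex_map L
  end.

Lemma fixlinear_member i : fixlinear s (member i).
Proof.
case: i => [[[[[[[e b] c] d]|[[[p al] mu] b]]|[[w a] b]]|[r g]]|[]] /=.
- exact: fixlinear_gab.
- exact: fixlinear_greek.
- exact: fixlinear_square.
- exact: fixlinear_pencil.
- exact: fixlinear_vertex.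
Qed.

Lemma trivker_member i : trivker (member i).
Proof.
case: i => [[[[[[[e b] c] d]|[[[p al] mu] b]]|[[w a] b]]|[r g]]|[]] /=.
- exact: trivker_gab.
- exact: trivker_greek (pvec_neq0 _).
- exact: trivker_square.
- exact: trivker_pencil (pvec_neq0 _).
- exact: trivker_vertex.
Qed.

Lemma pvec_nproportional i j : i <> j -> ~ proportional s (pvec i) (pvec j).
Proof. by move=> ne /pvec_proportional. Qed.

Lemma scale1_inj (k k' : F) : k%:A = k'%:A :> L -> k = k'.
Proof. exact: (fmorph_inj (in_alg L)). Qed.

Lemma member_meets i j : i != j ->
  meets s (member i) (member j) \/ meets s (member j) (member i).
Proof.
have pv := pvec_neq0.
case: i => [[[[[[[e b] c] d]|[[[p al] mu] b]]|[[w a] b]]|[r g]]|[]];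
  case: j => [[[[[[[e' b'] c'] d']|[[[p' al'] mu'] b']]|[[w' a'] b']]|[r' g']]|[]] ne //=.
- left; apply: meets_gab_gab; apply: contra_neq ne => -[/val_inj -> -> -> ->] //.
- by left; apply: meets_gab_greek; rewrite ?(valP e).
- by left; apply: meets_gab_square.
- by left; apply: meets_gab_pencil.
- by left; apply: meets_gab_vertex.
- by right; apply: meets_gab_greek; rewrite ?(valP e').
- left; have [pE|/eqP np] := eqVneq p p'; last first.
    by apply: meets_greek_greek_diff => //; apply: pvec_nproportional.
  rewrite -pE; apply: meets_greek_greek_same => //; rewrite -pE in ne.
  by apply: contra_neq ne => -[/scale1_inj -> -> ->].
- by left; apply: meets_greek_square.
- by left; apply: meets_greek_pencil.
- by left; apply: meets_greek_vertex.
- by right; apply: meets_gab_square.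
- by right; apply: meets_greek_square.
- left; have [wE|/eqP nw] := eqVneq w w'; last first.
    by apply: meets_square_square_diff => //; apply: pvec_nproportional.
  rewrite -wE; apply: meets_square_square_same; rewrite -wE in ne.
  by apply: contra_neq ne => -[-> ->].
- by right; apply: meets_pencil_square.
- by left; apply: meets_square_vertex.
- by right; apply: meets_gab_pencil.
- by right; apply: meets_greek_pencil.
- by left; apply: meets_pencil_square.
- left; have [rE|/eqP nr] := eqVneq r r'; last first.
    by apply: meets_pencil_pencil_diff => //; apply: pvec_nproportional => -[].
  rewrite -rE; apply: meets_pencil_pencil_same => //; rewrite -rE in ne.
  by apply: contra_neq ne => ->.
- by left; apply: meets_pencil_vertex.
- by right; apply: meets_gab_vertex.
- by right; apply: meets_greek_vertex.
- by right; apply: meets_square_vertex.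
- by right; apply: meets_pencil_vertex.
Qed.

Lemma card_index : \dim {:L} = 3%N -> let q := #|F| in
  #|{: index}| = (q ^ 12 + 2 * q ^ 8 + 2 * q ^ 7 + q ^ 6 + q ^ 5 + q ^ 4 + 1)%N.
Proof.
move=> dL q.
have cK : #|{: K}| = (q ^ 3)%N.
  transitivity #|(fullv : {vspace K})|; first by apply: eq_card => x; rewrite memvf.
  by rewrite card_vspace -[in RHS]dL.
have cK0 : #|{: {e : K | e != 0}}|.+1 = (q ^ 3)%N.
  rewrite card_sig -cK [in RHS](cardD1 (0 : K)) inE add1n; congr _.+1.
  by apply: eq_card => x; rewrite !inE andbT.
rewrite !(card_sum, card_prod, card_option, card_unit) cK -/q.
(* [m] stands for q^3 - 1, known only through [m.+1 = q ^ 3]; this avoids truncated subtraction. *)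
move: #|_| cK0 => m mE; clearbody q.
have -> : (q ^ 12 = m * q ^ 9 + q ^ 9)%N by rewrite -mulSnr mE -expnD.
by ring.
Qed.
End Family.

Theorem theorem3p13 (q : nat) (F : finFieldType) (hq : #|F| = q) :
  exists S : seq {vspace 'rV[F]_9},
    [/\ size S = (q ^ 12 + 2 * q ^ 8 + 2 * q ^ 7 + q ^ 6 + q ^ 5 + q ^ 4 + 1)%N,
        uniq S,
        (forall U, U \in S -> is_plane U) &
        (forall U V, U \in S -> V \in S -> U != V -> meet_at_most_point U V)].
Proof.
have [L dL] := cubic_extension F; have [s sE] := frobenius_rmorphism L.
have s3 := frobenius_cube dL sE; have s_fixed := frobenius_fixed sE.
have s_alg := frobenius_alg sE; have [th th_neq] := not_frobenius_fixed dL sE.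
have [eps tr_eps] := tr_onto s3 th_neq.
have [g g_inj] : exists g : 'Hom((L * L * L)%type, 'rV[F]_9), lker g == 0%VS.
  by apply: vect_iso_rV; rewrite dimvf -[LHS]/(_ + _ + _)%N -(dimvf L) dL.
pose U i := (g @: plane (member s eps th i))%VS.
have dU i : \dim (U i) = 3%N.
  rewrite /U limg_dim_eq ?(eqP g_inj) ?capv0 //.
  by rewrite (dim_plane s_alg) //; [apply: fixlinear_member | apply: trivker_member].
have mU i j : i != j -> (\dim (U i :&: U j) <= 1)%N.
  move=> ne; rewrite /U -lker0_img_cap // limg_dim_eq ?(eqP g_inj) ?capv0 //.
  have lin k := fixlinear_member s_alg eps th k.
  have [m|m] := member_meets s3 s_alg s_fixed tr_eps th_neq ne; last rewrite capvC.
    exact: plane_meet.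
  exact: plane_meet.
(* Equal planes with different indices would meet in dimension 3, contradicting [mU]. *)
have U_inj : injective U.
  move=> i j e; have [//|/mU] := eqVneq i j; by rewrite e capvv dU.
exists [seq U i | i <- enum {: index L}]; split.
- by rewrite size_map -cardE (card_index dL) hq.
- by rewrite map_inj_uniq // enum_uniq.
- by move=> _ /mapP[i _ ->]; rewrite /is_plane dU.
- move=> _ _ /mapP[i _ ->] /mapP[j _ ->] ne; apply: mU.
  by apply: contra_neq ne => ->.
Qed.
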